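(* Let $L\ge 1$ and $M\ge 3$ be integers. Suppose $y(t)=x(t)+n(t)$, $t=0,\dots,LM-1$, is divided into $M$ windows of length $L$, where $x(t)$ is a deterministic (real- or complex-valued) $L$-periodic signal and $n(t)$ is a length $LM$ sequence of i.i.d. real Gaussian random variables with mean zero and variance $\sigma^2$. Let $f\in\{0,\dots,L-1\}$ with $f\neq 0$ and $f\neq L/2$. Then $$\mathbb{E}(P_y(f))-|X(f)|^2=0,$$ where $P_y$ is the cross-correlation periodogram of $y$ and $X$ is the normalized discrete Fourier transform of one period of $x$.
   Context: $L$-periodic means $x(t+L)=x(t)$ for all $t$. $X(f)=\frac{1}{\sqrt L}\sum_{t=0}^{L-1}x(t)e^{-2\pi i f t/L}$ for $f=0,\dots,L-1$. The $m$-th noise window is $n_m(t):=n(mL+t)$, $t=0,\dots,L-1$, $m=0,\dots,M-1$, with transform $N_m(f)=\frac{1}{\sqrt L}\sum_{t=0}^{L-1}n_m(t)e^{-2\pi i f t/L}$. The transform (with the same normalization) of the $m$-th window of $y$ is $Y_m(f)=X(f)+N_m(f)$. The cross-correlation periodogram of $y$ is $P_y(f)=\frac1M\sum_{m=0}^{M-1}\mathrm{Re}\big[Y_m(f)\,Y_{m+1}(f)^*\big]$, where $*$ denotes complex conjugation and window indices are taken modulo $M$ (so $Y_M=Y_0$). *)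

(* Defs.v *)
From HB Require Import structures.
From mathcomp Require Import all_boot all_order all_algebra.
From mathcomp Require Import complex.
From mathcomp Require Import all_classical all_reals all_analysis.

Set Implicit Arguments.
Unset Strict Implicit.
Unset Printing Implicit Defensive.

Import Order.TTheory GRing.Theory Num.Theory.
Import numFieldNormedType.Exports.

Local Open Scope classical_set_scope.
Local Open Scope complex_scope.
Local Open Scope ring_scope.

(* exp(i theta) *)
Definition cis (R : realType) (theta : R) : R[i] := cos theta +i* sin theta.

Definition dft (R : realType) (L : nat) (x : 'I_L -> R[i]) (f : 'I_L) : R[i] :=
  ((Num.sqrt (L%:R : R))^-1)%:C *
  \sum_(t < L) x t * cis (- (2 * pi * f%:R * t%:R / L%:R)).

Lemma window_subproof (L M : nat) (m : 'I_M) (t : 'I_L) : (m * L + t < L * M)%N.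
Proof.
apply: (@leq_trans (m.+1 * L)%N); first by rewrite mulSn addnC ltn_add2r.
by rewrite [leqRHS]mulnC leq_mul2r ltn_ord orbT.
Qed.

Definition window (V : Type) (L M : nat) (y : 'I_(L * M) -> V) (m : 'I_M)
    (t : 'I_L) : V :=
  y (Ordinal (window_subproof m t)).

(* [ordS m] is the successor of m modulo M. *)
Definition xcorr_periodogram (R : realType) (L M : nat)
    (y : 'I_(L * M) -> R[i]) (f : 'I_L) : R :=
  M%:R^-1 *
  \sum_(m < M) complex.Re (dft (window y m) f * conjc (dft (window y (ordS m)) f)).

Definition mutually_independent (d d' : measure_display)
    (T : measurableType d) (T' : measurableType d') (R : realType)
    (P : probability T R) (I : finType) (X : I -> {RV P >-> T'}) : Prop :=
  forall (J : {set I}) (A : I -> set T'),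
    (forall i, measurable (A i)) ->
    P (\bigcap_(i in [set` J]) (X i @^-1` A i)) =
    (\prod_(i in J) P (X i @^-1` A i))%E.

(* Gaussian law with mean m and variance s^2.  The library's [normal_prob] is
   the uniform law on [0, 1] when s = 0, whereas the Gaussian law with zero
   variance is the point mass at m. *)
Definition gaussian_law (R : realType) (m s : R) :
    set (measurableTypeR R) -> \bar R :=
  if s == 0 then \d_m else normal_prob m s.

Definition has_gaussian_law (d : measure_display) (T : measurableType d)
    (R : realType) (P : probability T R)
    (X : {RV P >-> measurableTypeR R}) (m s : R) : Prop :=
  forall A : set (measurableTypeR R), measurable A ->
    distribution P X A = gaussian_law m s A.

(* Main.v *)
Require Import Defs.
From HB Require Import structures.
From mathcomp Require Import all_boot all_order all_algebra.
From mathcomp Require Import complex ring lra.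
From mathcomp Require Import all_classical all_reals all_analysis.
From mathcomp Require Import measurable_realfun.

Set Implicit Arguments.
Unset Strict Implicit.
Unset Printing Implicit Defensive.

Import Order.TTheory GRing.Theory Num.Theory.
Import numFieldNormedType.Exports.

Local Open Scope classical_set_scope.
Local Open Scope complex_scope.
Local Open Scope ring_scope.

(** The noise of each window has a transform N_m that is a linear combination
    of the samples of that window, so Y_m = X + N_m, where X does not depend on
    m because x is periodic.  Hence
      Re (Y_m Y_(m+1)^* )
        = |X|^2 + Re (N_m X^* ) + Re (N_(m+1) X^* ) + Re (N_m N_(m+1)^* ).
    The middle two terms are linear in the noise samples; the last one is a
    combination of products n_i n_j with i in window m and j in window m + 1.
    Cyclically consecutive windows are disjoint, so i and j always differ, and
    by independence E[n_i n_j] = E[n_i] E[n_j] = 0.  This is what the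
    cross-correlation gains over the ordinary periodogram, whose diagonal
    products n_i ^ 2 leave a bias.

    The predicate [centred] (integrable with expectation zero) is closed under
    linear combinations, so it suffices to see that it holds for one noise
    sample ([centred_gaussian]) and for the product of two independent centred
    variables ([centredM_indep]).  A Gaussian sample is integrable because
    |x| times the density of scale s is at most a constant times the density
    of scale s sqrt 2, and its expectation vanishes because its law is
    symmetric.  For a product, independence says that the joint law agrees
    with the product measure on rectangles, hence everywhere, and Fubini's
    theorem applies. *)

(** * The absolute first moment and the symmetry of the Gaussian law *)

Section normal.
Context (R : realType).
Local Notation mu := (@lebesgue_measure R).

(** The density agrees almost everywhere with the Radon-Nikodym derivative of
    the normal law, since both have the same integral on every measurable set;
    the formula for the derivative then gives the one for the density. *)
Lemma integral_normal_prob (m s : R) (g : measurableTypeR R -> \bar R) :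
  measurable_fun setT g -> (forall x, 0 <= g x)%E ->
  (\int[normal_prob m s]_x g x = \int[mu]_x (g x * (normal_pdf m s x)%:E))%E.
Proof.
move=> mg g0.
have dom : normal_prob m s `<< mu := normal_prob_dominates m s.
rewrite -(Radon_Nikodym_SigmaFinite.change_of_variables dom)//.
have mpdf : measurable_fun setT (EFin \o normal_pdf m s).
  by apply/measurable_EFinP; exact: measurable_normal_pdf.
have iRN := Radon_Nikodym_SigmaFinite.f_integrable dom.
apply: ae_eq_integral => //.
- by apply: emeasurable_funM => //; exact: measurable_int iRN.
- exact: emeasurable_funM.
- apply: ae_eqe_mul2l; apply: integral_ae_eq => //.
  by move=> E _ mE; rewrite -Radon_Nikodym_SigmaFinite.f_integral.
Qed.

(** With u = (x / s)^2 / 4, the Gaussian factor of scale s is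
    exp (- u) * exp (- u).  One exponential absorbs |x|, because
    |x| <= |s| (1 + u) <= |s| exp u, and the other is the Gaussian factor of
    scale s sqrt 2. *)
Lemma normr_mul_normal_pdf_le (s x : R) : s != 0 ->
  `|x| * normal_pdf 0 s x <=
  `|s| * Num.sqrt 2 * normal_pdf 0 (s * Num.sqrt 2) x.
Proof.
move=> s0.
have r2 : Num.sqrt 2 ^+ 2 = 2 :> R by rewrite sqr_sqrtr.
have r20 : Num.sqrt 2 != 0 :> R by rewrite sqrtr_eq0 -ltNge.
have s20 : s * Num.sqrt 2 != 0 by rewrite mulf_neq0.
rewrite !normal_pdfE//.
have -> : normal_peak s = Num.sqrt 2 * normal_peak (s * Num.sqrt 2).
  rewrite /normal_peak exprMn r2.
  rewrite (_ : s ^+ 2 * 2 * pi *+ 2 = 2 * (s ^+ 2 * pi *+ 2)); last by ring.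
  by rewrite [in RHS]sqrtrM// invfM mulrA divff// mul1r.
set p := normal_peak _.
have p0 : 0 <= p by exact: normal_peak_ge0.
pose u := (x / s) ^+ 2 / 4.
have u0 : 0 <= u by rewrite divr_ge0// sqr_ge0.
have -> : normal_fun 0 (s * Num.sqrt 2) x = expR (- u).
  by rewrite /normal_fun subr0 exprMn r2 /u; congr expR; field; rewrite s0.
have -> : normal_fun 0 s x = expR (- u) * expR (- u).
  by rewrite -expRD /normal_fun subr0 /u; congr expR; field; rewrite s0.
have absorb : `|x| * expR (- u) <= `|s|.
  rewrite expRN ler_pdivrMr ?expR_gt0//.
  apply: (@le_trans _ _ (`|s| * (1 + u))); last first.
    by rewrite ler_wpM2l// expR_ge1Dx.
  have -> : x = s * (x / s) by field.
  rewrite normrM ler_wpM2l// /u -(real_normK (num_real (x / s))).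
  (* (t / 2 - 1)^2 >= 0 is t <= 1 + t^2 / 4 *)
  by set t := `|x / s|; have := sqr_ge0 (t / 2 - 1); lra.
rewrite (_ : _ * _ =
  (`|x| * expR (- u)) * (Num.sqrt 2 * p * expR (- u))); last by ring.
rewrite [X in _ <= X](_ : _ =
  `|s| * (Num.sqrt 2 * p * expR (- u))); last by ring.
by rewrite ler_wpM2r// !mulr_ge0// expR_ge0.
Qed.

Lemma normal_prob_integrable_id (s : R) : s != 0 ->
  (normal_prob 0 s).-integrable setT (@EFin R).
Proof.
move=> s0; apply/integrableP; split; first by apply/measurable_EFinP.
rewrite integral_normal_prob//; last first.
  by apply: measurableT_comp => //; apply/measurable_EFinP.
pose C := `|s| * Num.sqrt 2.
apply: (@le_lt_trans _ _
   (\int[mu]_x (C%:E * (normal_pdf 0 (s * Num.sqrt 2) x)%:E))%E); last first.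
  rewrite integralZl//; last exact: integrable_normal_pdf.
  by rewrite integral_normal_pdf mule1 ltry.
have mpdf t :
    measurable_fun [set: measurableTypeR R] (EFin \o normal_pdf (0 : R) t).
  by apply/measurable_EFinP; exact: measurable_normal_pdf.
apply: ge0_le_integral => //.
- by move=> x _; rewrite mule_ge0// lee_fin normal_pdf_ge0.
- apply: emeasurable_funM; last exact: mpdf.
  by apply: measurableT_comp => //; apply/measurable_EFinP.
- exact: measurable_funeM (mpdf _).
- by move=> x _ /=; rewrite -EFinM lee_fin normr_mul_normal_pdf_le.
Qed.

Lemma normal_pdf_even (s x : R) : s != 0 ->
  normal_pdf 0 s (- x) = normal_pdf 0 s x.
Proof. by move=> s0; rewrite !normal_pdfE// /normal_fun !subr0 sqrrN. Qed.

Lemma normal_prob_sym (s : R) (A : set (measurableTypeR R)) : s != 0 ->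
  measurable A -> normal_prob 0 s (-%R @^-1` A) = normal_prob 0 s A.
Proof.
move=> s0 mA; rewrite /normal_prob.
have mpdf : measurable_fun setT (EFin \o normal_pdf (0 : R) s).
  by apply/measurable_EFinP; exact: measurable_normal_pdf.
transitivity (\int[pushforward mu (-%R : R -> measurableTypeR R)]_(x in A)
    (normal_pdf 0 s x)%:E)%E.
  rewrite ge0_integral_pushforward//=.
  - by apply: eq_integral => x _; rewrite normal_pdf_even.
  - exact: measurable_funTS.
  - by move=> x _; rewrite lee_fin normal_pdf_ge0.
by apply: eq_measure_integral => B mB _; exact: lebesgue_measureN.
Qed.

End normal.

(** * Integrable random variables of expectation zero *)

Section centred.
Local Open Scope ereal_scope.
Context d (T : measurableType d) (R : realType) (P : probability T R).

Definition centred (Z : T -> R) := Z \in Lfun P 1 /\ 'E_P[Z] = 0.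

Lemma centred0 : centred (cst 0%R).
Proof. by split; [exact: Lfun_cst|rewrite expectation_cst]. Qed.

Lemma centredD (Y Z : T -> R) :
  centred Y -> centred Z -> centred (fun w => Y w + Z w)%R.
Proof.
move=> [Y1 Y0] [Z1 Z0]; split.
  by rewrite [X in X \in _](_ : _ = Y + Z)%R// rpredD.
by rewrite (expectationD Y1 Z1) Y0 Z0 adde0.
Qed.

Lemma centredZ (k : R) (Z : T -> R) : centred Z -> centred (fun w => k * Z w)%R.
Proof.
move=> [Z1 Z0].
rewrite (_ : (fun w => _) = (k \o* Z)%R); last first.
  by apply/funext => w /=; rewrite mulrC.
by split; [exact: Lfun_scale|rewrite expectationZl// Z0 mule0].
Qed.

Lemma centred_sum (I : Type) (r : seq I) (Z : I -> T -> R) :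
  (forall i, centred (Z i)) -> centred (fun w => \sum_(i <- r) Z i w)%R.
Proof.
move=> cZ; elim: r => [|i r IHr].
  by under eq_fun do rewrite big_nil; exact: centred0.
by under eq_fun do rewrite big_cons; exact: centredD.
Qed.

Lemma expectation_addl_centred (c : R) (Z : T -> R) : centred Z ->
  'E_P[fun w => c + Z w]%R = c%:E.
Proof.
move=> [Z1 Z0].
by rewrite (expectationD (Lfun_cst P c 1) Z1) expectation_cst Z0 adde0.
Qed.

(** The law is invariant under the opposite, so its mean is equal to its own
    opposite; integrability makes it finite, hence zero. *)
Lemma centred_symmetric (X : {RV P >-> measurableTypeR R}) :
  (distribution P X).-integrable setT (@EFin R) ->
  (forall A : set (measurableTypeR R), measurable A ->
     distribution P X (-%R @^-1` A) = distribution P X A) ->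
  centred X.
Proof.
move=> iX symX.
have mE : measurable_fun [set: measurableTypeR R] (@EFin R).
  by case/integrableP: iX.
have iPX : P.-integrable setT (@EFin R \o X).
  apply/integrableP; split; first by apply: (measurableT_comp mE).
  have /integrableP[_] := iX.
  by rewrite ge0_integral_distribution//; exact: measurableT_comp.
split; first exact/Lfun1_integrable.
rewrite unlock -[LHS](integral_distribution mE iPX).
set I := integral _ _ _.
have mN :
    measurable_fun [set: measurableTypeR R] (-%R : _ -> measurableTypeR R).
  exact: oppr_measurable.
have IN : I = - I.
  rewrite /I -[RHS]integralN; last first.
    by apply: integrable_add_def.
  transitivity (\int[pushforward (distribution P X)
      (-%R : _ -> measurableTypeR R)]_x x%:E).
    by apply: eq_measure_integral => //= A mA _; exact/esym/symX.
  rewrite integral_pushforward//.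
  by apply: (integrableN iX).
have : I \is a fin_num by exact: integrable_fin_num.
move/fineK => Ifin; move: IN; rewrite -Ifin -EFinN => -[].
by move=> h; congr EFin; lra.
Qed.

(** Variance zero is treated apart: the law is then the point mass at 0 and has
    no density. *)
Lemma centred_gaussian (X : {RV P >-> measurableTypeR R}) (s : R) :
  has_gaussian_law X 0 s -> centred X.
Proof.
rewrite /has_gaussian_law /gaussian_law => hX.
have [s0|s0] := eqVneq s 0%R.
  rewrite s0 eqxx in hX; apply: centred_symmetric => [|A mA].
    apply/integrableP; split; first by apply/measurable_EFinP.
    rewrite (eq_measure_integral (dirac (0%R : measurableTypeR R)))
      => [|A mA _]; last exact: hX.
    rewrite integral_dirac//; last first.
      by apply: measurableT_comp => //; apply/measurable_EFinP.
    by rewrite diracT mul1e abse0 ltry.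
  have mNA : measurable (-%R @^-1` A : set (measurableTypeR R)).
    by rewrite -[X in measurable X]setTI; exact: (oppr_measurable measurableT).
  rewrite !hX// !diracE; congr (_%:R%:E).
  by congr nat_of_bool; apply/asbool_equiv_eq; rewrite /= oppr0.
rewrite (negbTE s0) in hX; apply: centred_symmetric => [|A mA].
  have /integrableP[mE iE] := normal_prob_integrable_id s0.
  apply/integrableP; split => //.
  by rewrite (eq_measure_integral (normal_prob 0 s))// => A mA _; exact: hX.
have mNA : measurable (-%R @^-1` A : set (measurableTypeR R)).
  by rewrite -[X in measurable X]setTI; exact: (oppr_measurable measurableT).
by rewrite !hX// normal_prob_sym.
Qed.

(** The product rule on rectangles determines the joint law of X and Y: it is
    the product of their laws.  Tonelli then bounds E|XY| by E|X| E|Y|, and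
    Fubini integrates y first, which already gives zero for each x. *)
Lemma centredM_indep (X Y : {RV P >-> measurableTypeR R}) :
  (forall A B : set (measurableTypeR R), measurable A -> measurable B ->
     P (X @^-1` A `&` Y @^-1` B) = P (X @^-1` A) * P (Y @^-1` B)) ->
  centred X -> centred Y -> centred (fun w => X w * Y w)%R.
Proof.
move=> indepXY [X1 _] [Y1 Y0].
pose mX := distribution P X; pose mY := distribution P Y.
(* the joint law of X and Y is the image of P by J *)
pose J : T -> measurableTypeR R * measurableTypeR R := fun w => (X w, Y w).
have mJ : measurable_fun [set: T] J by exact: measurable_fun_pair.
pose g (z : measurableTypeR R * measurableTypeR R) :=
  ((z.1 : R) * (z.2 : R))%R%:E : \bar R.
have mE : measurable_fun [set: measurableTypeR R] (@EFin R).
  by apply/measurable_EFinP.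
have mg : measurable_fun [set: measurableTypeR R * measurableTypeR R] g.
  by apply/measurable_EFinP/measurable_funM.
have mabs : measurable_fun [set: measurableTypeR R] (abse \o @EFin R).
  exact: measurableT_comp.
have finX : \int[mX]_x `|x%:E| < +oo.
  move/Lfun1_integrable/integrableP: X1 => [_].
  by rewrite ge0_integral_distribution.
have intY : mY.-integrable setT (@EFin R).
  apply/integrableP; split => //.
  move/Lfun1_integrable/integrableP: Y1 => [_].
  by rewrite ge0_integral_distribution.
have EY : \int[mY]_y y%:E = 0.
  rewrite integral_distribution//; last exact/Lfun1_integrable.
  by move: Y0; rewrite unlock.
have lawJ A : measurable A -> (mX \x mY) A = pushforward P J A.
  exact: (@product_measure_unique _ _ _ _ _ mX mY (pushforward P J)).
have ig : (mX \x mY).-integrable setT g.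
  apply/integrable12ltyP => //.
  have absg x : \int[mY]_y `|g (x, y)| = `|x%:E| * \int[mY]_y `|y%:E|.
    rewrite -ge0_integralZl//.
    by apply: eq_integral => y _; rewrite -abseM.
  under eq_integral do rewrite absg.
  rewrite /= ge0_integralZr//; last exact: integral_ge0.
  have X0 : 0 <= \int[mX]_x `|x%:E|.
    by apply: integral_ge0 => x _; exact: abse_ge0.
  by rewrite lte_mul_pinfty//; [rewrite ge0_fin_numE|case/integrableP: intY].
have igJ : P.-integrable setT (g \o J).
  have /integrableP[_ fing] := ig.
  apply/integrableP; split; first exact: measurableT_comp.
  move: fing; rewrite (eq_measure_integral (pushforward P J))
    => [|A mA _]; last exact: lawJ.
  by rewrite ge0_integral_pushforward//; exact: measurableT_comp.
split; first exact/Lfun1_integrable.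
rewrite unlock; transitivity (\int[pushforward P J]_z g z).
  by rewrite (integral_pushforward mJ mg).
rewrite (eq_measure_integral (mX \x mY)) => [|A mA _]; last exact/esym/lawJ.
rewrite -integral12_prod_meas1//.
apply: integral0_eq => x _.
transitivity (\int[mY]_y (x%:E * y%:E)); first exact: eq_integral.
by rewrite integralZl// EY mule0.
Qed.

End centred.

(** * Algebra of the cross-correlation *)

Section fourier.
Context (R : realType).
Implicit Types (a b c : R[i]).

Lemma Re_mulJC a b : complex.Re (a * conjc b) = complex.Re (b * conjc a).
Proof. by case: a b => [a1 a2] [b1 b2] /=; ring. Qed.

(** Real coefficients come out of the real part; this turns the real part of
    a noise transform times a constant into a real combination of samples. *)
Lemma Re_scale_sumM (I : Type) (r : seq I) (u : I -> R) (g : I -> R[i]) c :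
  complex.Re ((\sum_(i <- r) (u i)%:C * g i) * c) =
  \sum_(i <- r) complex.Re (g i * c) * u i.
Proof.
elim: r => [|i r IHr]; first by rewrite !big_nil mul0r.
rewrite !big_cons mulrDl -IHr.
by move: (g i) (\sum_(j <- r) _) (c) => [g1 g2] [s1 s2] [c1 c2] /=; ring.
Qed.

Lemma Re_shift_mulJ a b c :
  complex.Re ((c + a) * conjc (c + b)) =
  ComplexField.Normc.normc c ^+ 2 +
  (complex.Re (a * conjc c) + complex.Re (b * conjc c) +
   complex.Re (a * conjc b)).
Proof.
case: a b c => [a1 a2] [b1 b2] [c1 c2] /=.
by rewrite sqr_sqrtr ?addr_ge0 ?sqr_ge0//; ring.
Qed.

Definition dft_kernel (L : nat) (f t : 'I_L) : R[i] :=
  ((Num.sqrt (L%:R : R))^-1)%:C * cis (- (2 * pi * f%:R * t%:R / L%:R)).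

Lemma dftE (L : nat) (x : 'I_L -> R[i]) (f : 'I_L) :
  dft x f = \sum_(t < L) x t * dft_kernel f t.
Proof. by rewrite /dft mulr_sumr; apply: eq_bigr => t _; rewrite mulrCA. Qed.

Lemma dftD (L : nat) (x y : 'I_L -> R[i]) (f : 'I_L) :
  dft (fun t => x t + y t) f = dft x f + dft y f.
Proof. by rewrite !dftE -big_split; apply: eq_bigr => t _; rewrite mulrDl. Qed.

Lemma periodic_muln (V : Type) (L : nat) (x : nat -> V) :
  (forall t, x (t + L)%N = x t) -> forall m t, x (m * L + t)%N = x t.
Proof.
move=> hx; elim=> [//|m IHm] t.
by rewrite mulSn -addnA addnC hx.
Qed.

End fourier.

Definition window_index (L M : nat) (m : 'I_M) (t : 'I_L) : 'I_(L * M) :=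
  window id m t.

Lemma window_index_neq (L M : nat) (m m' : 'I_M) (t t' : 'I_L) :
  m != m' -> window_index m t != window_index m' t'.
Proof.
apply: contraNneq => /(congr1 val)/= e; apply/eqP/val_inj => /=.
have L0 : (0 < L)%N by apply: leq_ltn_trans (ltn_ord t).
have := congr1 (divn^~ L) e.
by rewrite !divnMDl// !divn_small// !addn0.
Qed.

Lemma ordS_neq (M : nat) (m : 'I_M) : (1 < M)%N -> m != ordS m.
Proof.
move=> M1; apply/eqP => /(congr1 val)/= e.
have mM := ltn_ord m.
move: e; have [lt|ge] := ltnP m.+1 M.
  by rewrite modn_small// => /eqP; rewrite ltn_eqF.
have -> : m.+1 = M by apply/eqP; rewrite eqn_leq mM ge.
by rewrite modnn => m0; move: ge; rewrite m0 leqNgt M1.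
Qed.

(** * Noise terms of the periodogram *)

Section noise.
Context d (T : measurableType d) (R : realType) (P : probability T R).

(** Take for J the pair {i, j}; that i and j differ makes it possible to
    prescribe A at i and B at j. *)
Lemma mutually_independent_pair (I : finType)
    (n : I -> {RV P >-> measurableTypeR R}) (i j : I) :
  mutually_independent n -> i != j ->
  forall A B : set (measurableTypeR R), measurable A -> measurable B ->
  (P (n i @^-1` A `&` n j @^-1` B) = P (n i @^-1` A) * P (n j @^-1` B))%E.
Proof.
move=> indep ij A B mA mB.
have := indep [set i; j]%SET (fun k => if k == i then A else B).
rewrite big_setU1 ?inE//= big_set1 eqxx eq_sym (negbTE ij) => <-; last first.
  by move=> k; case: ifP.
congr (P _); apply/seteqP; split => [w [Aw Bw] k /=|w h].
  by rewrite !inE => /orP[/eqP->|/eqP->]; rewrite ?eqxx// eq_sym (negbTE ij).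
split.
  by have := h i; rewrite /= !inE eqxx => /(_ isT).
by have := h j; rewrite /= !inE eqxx orbT eq_sym (negbTE ij) => /(_ isT).
Qed.

Lemma centred_Re_linear (L : nat) (u : 'I_L -> T -> R) (g : 'I_L -> R[i])
    (c : R[i]) : (forall t, centred P (u t)) ->
  centred P (fun w => complex.Re ((\sum_(t < L) (u t w)%:C * g t) * c)).
Proof.
move=> cu; under eq_fun do rewrite Re_scale_sumM.
by apply: centred_sum => t; exact: centredZ.
Qed.

(** The real part of N_u N_v^* is bilinear in the samples u and v, so only the
    products u s * v t matter; these involve every pair (s, t), so the two
    families must not share a sample. *)
Lemma centred_Re_sesquilinear (L : nat) (u v : 'I_L -> T -> R)
    (g : 'I_L -> R[i]) :
  (forall s t, centred P (fun w => u s w * v t w)) ->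
  centred P (fun w => complex.Re ((\sum_(s < L) (u s w)%:C * g s) *
                                  conjc (\sum_(t < L) (v t w)%:C * g t))).
Proof.
move=> cuv.
rewrite (_ : (fun w => _) = fun w => \sum_(s < L) \sum_(t < L)
    complex.Re (g t * conjc (g s)) * (u s w * v t w)); last first.
  apply/funext => w; rewrite Re_scale_sumM; apply: eq_bigr => s _.
  rewrite Re_mulJC Re_scale_sumM mulr_suml; apply: eq_bigr => t _.
  by rewrite mulrAC mulrA.
apply: centred_sum => s; apply: centred_sum => t; exact: centredZ.
Qed.

End noise.

(** * Unbiasedness of the cross-correlation periodogram *)

Theorem theorem2 (R : realType) (d : measure_display) (T : measurableType d)
    (P : probability T R) (L M : nat) (hL : (1 <= L)%N) (hM : (3 <= M)%N)
    (x : nat -> R[i]) (hx : forall t : nat, x (t + L)%N = x t)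
    (sigma : R) (n : 'I_(L * M) -> {RV P >-> measurableTypeR R})
    (hindep : mutually_independent n)
    (hgauss : forall t : 'I_(L * M), has_gaussian_law (n t) 0 sigma)
    (y : T -> 'I_(L * M) -> R[i])
    (hy : forall (w : T) (t : 'I_(L * M)), y w t = x t + (n t w)%:C)
    (f : 'I_L) (hf0 : (f : nat) <> 0%N) (hf2 : f%:R <> L%:R / 2 :> R) :
  ('E_P[fun w : T => xcorr_periodogram (y w) f]
   - ((ComplexField.Normc.normc (dft (fun t : 'I_L => x t) f)) ^+ 2)%:E = 0)%E.
Proof.
set X := dft (fun t : 'I_L => x t) f.
have cn i : centred P (n i) := centred_gaussian (hgauss i).
pose N m w := dft (window (fun i => (n i w)%:C) m) f.
have YE m w : dft (window (y w) m) f = X + N m w.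
  rewrite /X /N -dftD; congr dft; apply/funext => t.
  by rewrite /window hy /= periodic_muln.
pose Z m w :=
  complex.Re (N m w * conjc X) + complex.Re (N (ordS m) w * conjc X) +
  complex.Re (N m w * conjc (N (ordS m) w)).
have cZ m : centred P (Z m).
  rewrite /Z /N; under eq_fun do rewrite !dftE.
  apply: centredD; first apply: centredD.
  - by apply: centred_Re_linear => t; exact: cn.
  - by apply: centred_Re_linear => t; exact: cn.
  - apply: centred_Re_sesquilinear => s t; apply: centredM_indep (cn _) (cn _).
    apply: mutually_independent_pair hindep _.
    by apply: window_index_neq; rewrite ordS_neq// ltnW.
have -> : (fun w => xcorr_periodogram (y w) f) =
    fun w => ComplexField.Normc.normc X ^+ 2 + M%:R^-1 * \sum_(m < M) Z m w.
  apply/funext => w; rewrite /xcorr_periodogram.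
  under eq_bigr do rewrite !YE Re_shift_mulJ.
  rewrite big_split /= sumr_const card_ord mulrDr.
  rewrite -[X in _ * X + _]mulr_natl mulKf//.
  by rewrite pnatr_eq0 -lt0n (leq_trans _ hM).
rewrite expectation_addl_centred ?subee//.
by apply: centredZ; exact: centred_sum.
Qed.
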